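(* Let $G$ be a commutative group, let $h\colon R\to S$ be a morphism of $G$-graded commutative rings, and let $\underline h\colon R\to h_*(S)$ denote $h$ considered as a morphism in $\mathrm{Mod}^G(R)$. a) $\rho^h$ is a monomorphism (respectively an epimorphism, respectively an isomorphism) if and only if $\underline h$ is pure (respectively an epimorphism, respectively an isomorphism) in $\mathrm{Mod}^G(R)$. b) $\widetilde\sigma^h$ is a monomorphism (respectively an epimorphism, respectively an isomorphism) if and only if $\underline h$ is an epimorphism (respectively a section, respectively an isomorphism) in $\mathrm{Mod}^G(R)$.
   Context: All groups and rings are commutative (rings unital). $\mathrm{Mod}^G(R)$ is the category of $G$-graded $R$-modules with degree-preserving $R$-linear maps; $M(g)$ is the shift, $M(g)_{g'}=M_{g+g'}$. The tensor product $M\otimes_RN$ is graded with $x\otimes y$ in degree $\deg x+\deg y$. $\mathrm{Hom}^G_R(M,N)=\bigoplus_{g\in G}\mathrm{Hom}_{\mathrm{Mod}^G(R)}(M,N(g))$, a $G$-graded $R$-module. $h_*\colon\mathrm{Mod}^G(S)\to\mathrm{Mod}^G(R)$ is restriction of scalars along $h$. $h^*(M)=S\otimes_RM$ (the graded tensor product $h_*(S)\otimes_RM$ with $s(t\otimes x)=(st)\otimes x$). $\widetilde h(M)=\mathrm{Hom}^G_R(h_*(S),M)$ with $S$-action $(su)(t)=u(st)$. For $M$ in $\mathrm{Mod}^G(R)$: $\rho^h_M\colon M\to h_*(h^*(M))$, $x\mapsto1_S\otimes x$, and $\widetilde\sigma^h_M\colon h_*(\widetilde h(M))\to M$, $u\mapsto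 u(1_S)$. A natural transformation is called a mono-, epi- or isomorphism if each of its components is so. A morphism $u\colon M\to N$ in $\mathrm{Mod}^G(R)$ is pure if $u\otimes_RP\colon M\otimes_RP\to N\otimes_RP$ is a monomorphism for every $G$-graded $R$-module $P$; it is a section if there is $v\colon N\to M$ in $\mathrm{Mod}^G(R)$ with $v\circ u=\mathrm{Id}_M$. *)

(* Defs.v *)
From HB Require Import structures.
From mathcomp Require Import all_boot all_algebra.
From mathcomp Require Import boolp classical_sets functions.
From mathcomp.multinomials Require Import freeg.

Set Implicit Arguments.
Unset Strict Implicit.
Unset Printing Implicit Defensive.

Import GRing.Theory.
Local Open Scope ring_scope.
Local Open Scope quotient_scope.

(* M (x)_R N is the quotient of the free abelian group on M * N by the
   subgroup generated by the R-balanced relations. *)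
Section TensorDef.
Variables (R : comPzRingType) (M N : lmodType R).

Inductive tens_null : {freeg (M * N)%type / int} -> Prop :=
| tens_null0 : tens_null 0
| tens_nullB u v : tens_null u -> tens_null v -> tens_null (u - v)
| tens_nullDl x x' y :
    tens_null (<< (x + x', y) >> - << (x, y) >> - << (x', y) >>)
| tens_nullDr x y y' :
    tens_null (<< (x, y + y') >> - << (x, y) >> - << (x, y') >>)
| tens_nullZ (r : R) x y :
    tens_null (<< (r *: x, y) >> - << (x, r *: y) >>).

Definition tens_ideal : {pred {freeg (M * N)%type / int}} :=
  fun u => `[< tens_null u >].

Fact tens_ideal_zmod_closed : zmod_closed tens_ideal.
Proof.
split; first exact/asboolP/tens_null0.
by move=> u v /asboolP Hu /asboolP Hv; exact/asboolP/tens_nullB.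
Qed.
HB.instance Definition _ := GRing.isZmodClosed.Build _ tens_ideal
  tens_ideal_zmod_closed.

Definition tens_subgroup : zmodClosed {freeg (M * N)%type / int} :=
  GRing.ZmodClosed.clone _ tens_ideal _.

Definition tens : Type := Quotient.quot tens_subgroup.
HB.instance Definition _ := GRing.Zmodule.on tens.
Definition tmk (x : M) (y : N) : tens :=
  \pi_(Quotient.quot tens_subgroup) << (x, y) >>.

Record balanced (A : zmodType) (f : M -> N -> A) : Prop := Balanced {
  balDl : forall x x' y, f (x + x') y = f x y + f x' y;
  balDr : forall x y y', f x (y + y') = f x y + f x y';
  balZ : forall r x y, f (r *: x) y = f x (r *: y) }.

Definition tlift (A : zmodType) (f : M -> N -> A) (t : tens) : A :=
  fglift (fun p : M * N => f p.1 p.2 : zmodule A)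
    (repr (t : Quotient.quot tens_subgroup)).

Lemma piB u v : \pi_(Quotient.quot tens_subgroup) (u - v) =
  \pi_(Quotient.quot tens_subgroup) u - \pi_(Quotient.quot tens_subgroup) v.
Proof. by rewrite !piE. Qed.

Lemma pi_tens_null u : tens_null u -> \pi_(Quotient.quot tens_subgroup) u = 0.
Proof.
move=> Hu; rewrite -[0]/(Quotient.zero tens_subgroup) /Quotient.zero.
unlock; apply/eqP; rewrite -Quotient.idealrBE subr0; exact/asboolP.
Qed.

Lemma tmk_balanced : balanced tmk.
Proof.
split=> [x x' y|x y y'|r x y]; apply/eqP; rewrite -subr_eq0 ?opprD ?addrA;
  rewrite /tmk -!piB; apply/eqP; apply: pi_tens_null.
- exact: tens_nullDl.
- exact: tens_nullDr.
- exact: tens_nullZ.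
Qed.

Lemma tens_ind (P : tens -> Prop) :
  P 0 -> (forall t u, P t -> P u -> P (t - u)) -> (forall x y, P (tmk x y)) ->
  forall t, P t.
Proof.
move=> P0 PB Pm.
have PN t : P t -> P (- t).
  by move=> Pt; rewrite -sub0r; exact: PB.
elim/quotW => D; rewrite -(freeg_sumE D).
elim: (dom D) => [|p s IHs]; first by rewrite big_nil pi_tens_null //; constructor.
rewrite big_cons -[X in X + _]opprK addrC piB; apply: (PB); first exact: IHs.
rewrite -sub0r piB (pi_tens_null (tens_null0)) sub0r; apply: (PN).
have -> : << coeff p D *g p >> = << p >> *~ coeff p D.
  by rewrite freegU_mulz intz.
have Pn n : P (\pi_(Quotient.quot tens_subgroup) (<< p >> *+ n)).
  elim: n => [|n IHn]; first by rewrite mulr0n pi_tens_null //; constructor.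
  rewrite mulrS -[X in X + _]opprK addrC piB; apply: (PB) => //.
  rewrite -sub0r piB (pi_tens_null tens_null0) sub0r; apply: (PN).
  by case: (p) => x y; exact: Pm.
case: (coeff p D) => n; first exact: Pn.
rewrite NegzE mulrNz -sub0r piB (pi_tens_null tens_null0) sub0r.
apply: PN; exact: Pn.
Qed.

Section Lift.
Variables (A : zmodType) (f : M -> N -> A) (fb : balanced f).

Let F (D : {freeg (M * N)%type / int}) : zmodule A :=
  fglift (fun p : M * N => f p.1 p.2 : zmodule A) D.

Let FB u v : F (u - v) = F u - F v.
Proof. exact: lift_is_additive. Qed.

Let F1 x y : F << (x, y) >> = f x y.
Proof. by rewrite /F liftU scale1r. Qed.

Let F_null u : tens_null u -> F u = 0.
Proof.
elim=> [|{}u v _ Fu _ Fv|x x' y|x y y'|r x y].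
- by rewrite -(subrr 0) FB subrr.
- by rewrite FB Fu Fv subrr.
- by rewrite !FB !F1 (balDl fb) addrAC [X in X - _]addrK subrr.
- by rewrite !FB !F1 (balDr fb) addrAC [X in X - _]addrK subrr.
- by rewrite !FB !F1 (balZ fb) subrr.
Qed.

Let tlift_pi D : tlift f (\pi_(Quotient.quot tens_subgroup) D) = F D.
Proof.
apply/eqP; rewrite -subr_eq0 -[X in X - _]/(F _) -FB; apply/eqP.
apply: F_null; apply/asboolP.
have : repr (\pi_(Quotient.quot tens_subgroup) D) == D
  %[mod Quotient.quot tens_subgroup] by rewrite reprK.
by rewrite -Quotient.idealrBE.
Qed.

Lemma tlift_tmk x y : tlift f (tmk x y) = f x y.
Proof. by rewrite /tmk tlift_pi F1. Qed.

Lemma tliftB : zmod_morphism (tlift f).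
Proof.
by elim/quotW=> u; elim/quotW=> v; rewrite -piB !tlift_pi FB.
Qed.

Lemma tliftD t u : tlift f (t + u) = tlift f t + tlift f u.
Proof.
have T0 : tlift f 0 = 0 by rewrite -[X in tlift f X](subrr 0) tliftB subrr.
have TN v : tlift f (- v) = - tlift f v.
  by rewrite -[- v]sub0r tliftB T0 sub0r.
by rewrite -{1}[u]opprK tliftB TN opprK.
Qed.

End Lift.

End TensorDef.

Arguments tens {R} M N.
Notation "x ⊗ y" := (tmk x y) (at level 40, left associativity) : ring_scope.

Section TensorModule.
Variable R : comPzRingType.

Lemma tens_ext (M N : lmodType R) (A : zmodType) (F F' : tens M N -> A) :
  zmod_morphism F -> zmod_morphism F' ->
  (forall x y, F (x ⊗ y) = F' (x ⊗ y)) -> F =1 F'.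
Proof.
move=> FB FB' FF'; elim/tens_ind => [|t u Ft Fu|//]; last first.
  by rewrite FB FB' Ft Fu.
by rewrite -(subrr (0 : tens M N)) FB FB' !subrr.
Qed.

Section Scale.
Variables M N : lmodType R.

Lemma tscale_balanced (r : R) :
  balanced (fun (x : M) (y : N) => (r *: x) ⊗ y).
Proof.
have [Dl Dr Z] := tmk_balanced M N.
split=> [x x' y|x y y'|a x y]; rewrite ?scalerDr ?Dl ?Dr //.
by rewrite scalerA mulrC -scalerA Z.
Qed.

Definition tscale (r : R) : tens M N -> tens M N :=
  tlift (fun x y => (r *: x) ⊗ y).

Lemma tscaleE r x y : tscale r (x ⊗ y) = (r *: x) ⊗ y.
Proof. exact/tlift_tmk/tscale_balanced. Qed.

Lemma tscaleDr : right_distributive tscale +%R.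
Proof. by move=> r; exact/tliftD/tscale_balanced. Qed.

Lemma tscaleBr r : zmod_morphism (tscale r).
Proof. exact/tliftB/tscale_balanced. Qed.

Lemma tscaleA a b t : tscale a (tscale b t) = tscale (a * b) t.
Proof.
apply: (tens_ext (F := tscale a \o tscale b) (F' := tscale (a * b))) t.
- by move=> t u /=; rewrite !tscaleBr.
- exact: tscaleBr.
- by move=> x y /=; rewrite !tscaleE scalerA.
Qed.

Lemma tscale1 : left_id 1 tscale.
Proof.
apply: (tens_ext (F' := idfun)) => //; first exact: tscaleBr.
by move=> x y /=; rewrite tscaleE scale1r.
Qed.

Lemma tscaleDl t : {morph tscale^~ t : a b / a + b}.
Proof.
move=> a b /=.
apply: (tens_ext (F' := fun u => tscale a u + tscale b u)) t => /=.
- exact: tscaleBr.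
- by move=> t u; rewrite !tscaleBr opprD addrACA.
- by move=> x y; rewrite !tscaleE scalerDl (balDl (tmk_balanced M N)).
Qed.

HB.instance Definition _ := GRing.Zmodule_isLmodule.Build R (tens M N)
  tscaleA tscale1 tscaleDr tscaleDl.

Lemma scale_tmk (r : R) (x : M) (y : N) : r *: (x ⊗ y) = (r *: x) ⊗ y.
Proof. exact: tscaleE. Qed.

End Scale.

Section Map.
Variables M M' N N' : lmodType R.
Variables (u : {linear M -> M'}) (v : {linear N -> N'}).

Lemma tmap_balanced : balanced (fun x y => u x ⊗ v y).
Proof.
have [Dl Dr Z] := tmk_balanced M' N'.
by split=> [x x' y|x y y'|r x y]; rewrite ?linearD ?linearZ ?Dl ?Dr /= ?Z.
Qed.

Definition tmap : tens M N -> tens M' N' := tlift (fun x y => u x ⊗ v y).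

Lemma tmapE x y : tmap (x ⊗ y) = u x ⊗ v y.
Proof. exact/tlift_tmk/tmap_balanced. Qed.

Lemma tmapB : zmod_morphism tmap.
Proof. exact/tliftB/tmap_balanced. Qed.

Lemma tmapZ : scalable tmap.
Proof.
move=> r; apply: (tens_ext (F := tmap \o *:%R r) (F' := *:%R r \o tmap)).
- by move=> t w /=; rewrite scalerBr tmapB.
- by move=> t w /=; rewrite tmapB scalerBr.
- by move=> x y /=; rewrite scale_tmk !tmapE scale_tmk linearZ.
Qed.

HB.instance Definition _ :=
  GRing.isZmodMorphism.Build (tens M N) (tens M' N') tmap tmapB.
HB.instance Definition _ :=
  GRing.isScalable.Build R (tens M N) (tens M' N') *:%R tmap tmapZ.

End Map.
End TensorModule.

Section Grading.
Variables (G V : zmodType).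
Implicit Type P : G -> V -> Prop.

Definition sum_of P (x : V) : Prop :=
  exists (s : seq G) (f : G -> V),
    (forall g, P g (f g)) /\ x = \sum_(g <- s) f g.

Record subgroup_family P : Prop := SubgroupFamily {
  part0 : forall g, P g 0;
  partB : forall g x y, P g x -> P g y -> P g (x - y) }.

(* V is the internal direct sum of the subgroups P g. *)
Record is_grading P : Prop := IsGrading {
  grading_sub :> subgroup_family P;
  grading_span : forall x, sum_of P x;
  grading_free : forall (s : seq G) (f : G -> V), uniq s ->
    (forall g, P g (f g)) -> \sum_(g <- s) f g = 0 ->
    forall g, g \in s -> f g = 0 }.

Lemma sum_extend (s t : seq G) (f : G -> V) :
  uniq s -> uniq t -> {subset s <= t} -> (forall g, g \notin s -> f g = 0) ->
  \sum_(g <- s) f g = \sum_(g <- t) f g.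
Proof.
move=> us ut st f0; rewrite [RHS](bigID (mem s)) /=.
rewrite [X in _ + X]big1 ?addr0; last by move=> g /f0.
rewrite -[RHS]big_filter; apply: perm_big; apply: uniq_perm => //.
  exact: filter_uniq.
by move=> g; rewrite mem_filter; case: (boolP (g \in s)) => // /st ->.
Qed.

Section Family.
Variables (P : G -> V -> Prop) (subP : subgroup_family P).

Lemma partN g x : P g x -> P g (- x).
Proof. by move=> Px; rewrite -sub0r; apply: partB => //; exact: part0. Qed.

Lemma partD g x y : P g x -> P g y -> P g (x + y).
Proof. by move=> Px Py; rewrite -[y]opprK; apply: partB => //; exact: partN. Qed.

Lemma partMn g x n : P g x -> P g (x *+ n).
Proof.
move=> Px; elim: n => [|n IHn]; first exact: part0.
by rewrite mulrS; exact: partD.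
Qed.

Definition dec (x : V) (s : seq G) (f : G -> V) : Prop :=
  [/\ uniq s, forall g, P g (f g), forall g, g \notin s -> f g = 0
   & x = \sum_(g <- s) f g].

Lemma dec_sum_of x s f : dec x s f -> sum_of P x.
Proof. by case=> _ Pf _ xE; exists s, f. Qed.

Lemma sum_of_dec x : sum_of P x -> exists s f, dec x s f.
Proof.
case=> s [f [Pf ->]]; exists (undup s), (fun g => f g *+ count_mem g s).
split=> [|g|g|]; first exact: undup_uniq.
- exact: partMn.
- by rewrite mem_undup => gs; rewrite (count_memPn gs).
- rewrite -[LHS]big_undup_iterop_count /=; apply: eq_bigr => g _.
  by elim: (count_mem g s) => // -[|n] //= ->; rewrite [in RHS]mulrS.
Qed.

Lemma dec_extend x s f t :
  dec x s f -> uniq t -> {subset s <= t} -> dec x t f.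
Proof.
case=> us Pf f0 -> ut st; split=> // [g gt|]; last exact: sum_extend.
by apply: f0; apply: contra gt; exact: st.
Qed.

Lemma dec_common x y s t f f' : dec x s f -> dec y t f' ->
  exists r, [/\ {subset s <= r}, {subset t <= r}, dec x r f & dec y r f'].
Proof.
move=> dx dy; exists (undup (s ++ t)).
have sr : {subset s <= undup (s ++ t)}.
  by move=> g gs; rewrite mem_undup mem_cat gs.
have tr : {subset t <= undup (s ++ t)}.
  by move=> g gt; rewrite mem_undup mem_cat gt orbT.
by split=> //; apply: dec_extend; eauto; exact: undup_uniq.
Qed.

Lemma decB x y s f f' : dec x s f -> dec y s f' ->
  dec (x - y) s (fun g => f g - f' g).
Proof.
case=> us Pf f0 -> [_ Pf' f0' ->]; split=> // [g|g gs|].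
- exact: partB.
- by rewrite f0 // f0' // subrr.
- by rewrite sumrB.
Qed.

Lemma dec_homog g x : P g x -> dec x [:: g] (fun d => if d == g then x else 0).
Proof.
move=> Px; split=> // [d|d|].
- by case: eqP => [->|_] //; exact: part0.
- by rewrite mem_seq1 => /negbTE ->.
- by rewrite big_seq1 eqxx.
Qed.

Lemma sum_of_homog g x : P g x -> sum_of P x.
Proof. by move=> /dec_homog; exact: dec_sum_of. Qed.

Lemma sum_of0 : sum_of P 0.
Proof. exact: (sum_of_homog (part0 subP 0)). Qed.

Lemma sum_ofB x y : sum_of P x -> sum_of P y -> sum_of P (x - y).
Proof.
move=> /sum_of_dec [s [f dx]] /sum_of_dec [t [f' dy]].
have [r [_ _ dx' dy']] := dec_common dx dy.
exact: (dec_sum_of (decB dx' dy')).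
Qed.

Lemma sum_ofD x y : sum_of P x -> sum_of P y -> sum_of P (x + y).
Proof.
move=> Px Py; rewrite -[y]opprK; apply: sum_ofB => //.
by rewrite -sub0r; apply: sum_ofB => //; exact: sum_of0.
Qed.

Lemma sum_of_sum (I : Type) (s : seq I) (F : I -> V) :
  (forall i, sum_of P (F i)) -> sum_of P (\sum_(i <- s) F i).
Proof.
by move=> PF; elim/big_ind: _ => //; [exact: sum_of0 | exact: sum_ofD].
Qed.

End Family.

Section Components.
Variables (P : G -> V -> Prop) (grP : is_grading P).

Lemma dec_ex x : exists s f, dec P x s f.
Proof. exact/sum_of_dec/(grading_span grP)/(grading_sub grP). Qed.

Definition gsupp x : seq G := sval (cid (dec_ex x)).
Definition gcomp (g : G) x : V := sval (cid (svalP (cid (dec_ex x)))) g.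

Lemma gcomp_dec x : dec P x (gsupp x) (gcomp^~ x).
Proof. exact: (svalP (cid (svalP (cid (dec_ex x))))). Qed.

Lemma gcomp_unique x s f : dec P x s f -> gcomp^~ x =1 f.
Proof.
move=> dx; have [r [_ _ dx1 dx2]] := dec_common (gcomp_dec x) dx.
have [ur Pf f0] := decB grP dx1 dx2; rewrite subrr => /esym sum0 g.
apply/eqP; rewrite -subr_eq0; apply/eqP.
have [gr|] := boolP (g \in r); last exact: f0.
exact: (grading_free grP ur Pf sum0).
Qed.

Lemma gcompB g : zmod_morphism (gcomp g).
Proof.
move=> x y; have [r [_ _ dx dy]] := dec_common (gcomp_dec x) (gcomp_dec y).
exact: (gcomp_unique (decB grP dx dy)).
Qed.

Lemma gcomp_homog g d x : P d x -> gcomp g x = if g == d then x else 0.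
Proof. by move=> /(dec_homog grP)/gcomp_unique. Qed.

Lemma homog_ext (A : zmodType) (F F' : V -> A) :
  zmod_morphism F -> zmod_morphism F' ->
  (forall g x, P g x -> F x = F' x) -> F =1 F'.
Proof.
move=> FB FB' FF' x; have [s [f [Pf ->]]] := grading_span grP x.
pose H := GRing.isZmodMorphism.Build V A F FB.
pose H' := GRing.isZmodMorphism.Build V A F' FB'.
pose f1 : {additive V -> A} := HB.pack F H.
pose f2 : {additive V -> A} := HB.pack F' H'.
rewrite -[F]/(f1 : V -> A) -[F']/(f2 : V -> A) !raddf_sum.
by apply: eq_bigr => g _; exact: FF'.
Qed.

End Components.
End Grading.

Record gradedRing (G : zmodType) := GradedRing {
  gr_ring :> comPzRingType;
  rpart : G -> gr_ring -> Prop;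
  rpart_grading : is_grading rpart;
  rpart1 : rpart 0 1; (* implied by the other fields, as G is a group *)
  rpartM : forall g g' a b, rpart g a -> rpart g' b -> rpart (g + g') (a * b) }.
Arguments rpart {G} g0 _ _ : rename.

Record gradedRingMor (G : zmodType) (R S : gradedRing G) := GradedRingMor {
  grm_fun :> {rmorphism R -> S};
  grm_deg : forall g a, rpart R g a -> rpart S g (grm_fun a) }.

Record gradedModule (G : zmodType) (R : gradedRing G) := GradedModule {
  gm_mod :> lmodType R;
  mpart : G -> gm_mod -> Prop;
  mpart_grading : is_grading mpart;
  mpartZ : forall g g' a x,
    rpart R g a -> mpart g' x -> mpart (g + g') (a *: x) }.
Arguments mpart {G R} M _ _ : rename.

Record gradedMor (G : zmodType) (R : gradedRing G) (M N : gradedModule R) :=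
  GradedMor {
    gmor_fun :> {linear M -> N};
    gmor_deg : forall g x, mpart M g x -> mpart N g (gmor_fun x) }.

Section Category.
Variables (G : zmodType) (R : gradedRing G).
Implicit Types M N K : gradedModule R.

Definition is_mono M N (u : gradedMor M N) : Prop :=
  forall K (v w : gradedMor K M), u \o v =1 u \o w -> v =1 w.

Definition is_epi M N (u : gradedMor M N) : Prop :=
  forall K (v w : gradedMor N K), v \o u =1 w \o u -> v =1 w.

Definition is_iso M N (u : gradedMor M N) : Prop :=
  exists v : gradedMor N M, v \o u =1 id /\ u \o v =1 id.

Definition is_section M N (u : gradedMor M N) : Prop :=
  exists v : gradedMor N M, v \o u =1 id.

Lemma regular_partZ g g' (a : R) (x : R^o) :
  rpart R g a -> rpart R g' x -> rpart R (g + g') (a *: x).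
Proof. exact: rpartM. Qed.

Definition regular : gradedModule R :=
  @GradedModule G R (R^o : lmodType R) (rpart R) (rpart_grading R) regular_partZ.

Section Shift.
Variables (M : gradedModule R) (h : G).

Definition shift_part (g : G) (x : M) : Prop := mpart M (h + g) x.

Lemma shift_grading : is_grading shift_part.
Proof.
have grM := mpart_grading M.
split=> [|x|s f us Pf sum0 g gs].
- by split=> [g|g x y]; [exact: part0 grM _ | exact: partB grM _ _ _].
- have [s [f [Pf ->]]] := grading_span grM x.
  exists [seq g - h | g <- s], (fun g => f (h + g)); split=> [g|]; first exact: Pf.
  by rewrite big_map; apply: eq_bigr => g _; rewrite addrC subrK.
- rewrite -[g](addKr h) [- h + _]addrC.
  apply: (grading_free (s := [seq h + d | d <- s]) (f := fun d => f (d - h)) grM).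
  + by rewrite map_inj_uniq //; exact: addrI.
  + by move=> d; have := Pf (d - h); rewrite /shift_part addrC subrK.
  + by rewrite big_map -[RHS]sum0; apply: eq_bigr => d _; rewrite addrC addKr.
  + exact: map_f.
Qed.

Lemma shift_partZ g g' (a : R) (x : M) :
  rpart R g a -> shift_part g' x -> shift_part (g + g') (a *: x).
Proof. by rewrite /shift_part addrCA; exact: mpartZ. Qed.

(* M(h), with M(h)_g = M_(h + g) *)
Definition shift : gradedModule R := GradedModule shift_grading shift_partZ.

End Shift.

Section Tensor.
Variables M N : gradedModule R.

Definition tens_part (g : G) (t : tens M N) : Prop :=
  exists s : seq (M * N),
    (forall p, p \in s -> exists a b,
       [/\ mpart M a p.1, mpart N b p.2 & a + b = g]) /\
    t = \sum_(p <- s) p.1 ⊗ p.2.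

Let grM := mpart_grading M.
Let grN := mpart_grading N.
Let tb := tmk_balanced M N.

Lemma tmk0l y : (0 : M) ⊗ y = 0 :> tens M N.
Proof. by apply: (addrI (0 ⊗ y)); rewrite -(balDl tb) !addr0. Qed.

Lemma tmk0r x : x ⊗ (0 : N) = 0 :> tens M N.
Proof. by apply: (addrI (x ⊗ 0)); rewrite -(balDr tb) !addr0. Qed.

Lemma tmkNl x y : (- x) ⊗ y = - (x ⊗ y) :> tens M N.
Proof. by apply/eqP; rewrite -addr_eq0 -(balDl tb) addNr tmk0l. Qed.

Lemma tmkNr x y : x ⊗ (- y) = - (x ⊗ y) :> tens M N.
Proof. by apply/eqP; rewrite -addr_eq0 -(balDr tb) addNr tmk0r. Qed.

Lemma tmkBl x x' y : (x - x') ⊗ y = x ⊗ y - x' ⊗ y :> tens M N.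
Proof. by rewrite (balDl tb) tmkNl. Qed.

Lemma tmkBr x y y' : x ⊗ (y - y') = x ⊗ y - x ⊗ y' :> tens M N.
Proof. by rewrite (balDr tb) tmkNr. Qed.

Lemma tens_part_tmk a b g x y :
  mpart M a x -> mpart N b y -> a + b = g -> tens_part g (x ⊗ y).
Proof.
move=> Mx Ny ab; exists [:: (x, y)]; rewrite big_seq1; split=> // p.
by rewrite mem_seq1 => /eqP ->; exists a, b.
Qed.

Lemma tens_part_subgroup : subgroup_family tens_part.
Proof.
split=> [g|g t u [s [Ps ->]] [s' [Ps' ->]]].
  by exists [::]; rewrite big_nil.
exists (s ++ [seq (- p.1, p.2) | p <- s']); split=> [p|].
  rewrite mem_cat => /orP[/Ps //|/mapP[q /Ps' [a [b [Mq Nq ab]]] ->]].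
  by exists a, b; split=> //; exact: (partN grM).
rewrite big_cat big_map /= -sumrN; congr (_ + _).
by apply: eq_bigr => p _; rewrite tmkNl.
Qed.

Definition tc (g : G) (x : M) (y : N) : tens M N :=
  \sum_(a <- gsupp grM x) gcomp grM a x ⊗ gcomp grN (g - a) y.

Lemma tc_dec g x y s f : dec (mpart M) x s f ->
  tc g x y = \sum_(a <- s) f a ⊗ gcomp grN (g - a) y.
Proof.
move=> dx; have [r [sr tr dr dr']] := dec_common (gcomp_dec grM x) dx.
have [us _ f0 _] := dx; have [us' _ f0' _] := gcomp_dec grM x.
have [ur _ _ _] := dr.
rewrite /tc (sum_extend us' ur sr) => [|a /f0' ->]; last by rewrite tmk0l.
rewrite (sum_extend us ur tr) => [|a /f0 ->]; last by rewrite tmk0l.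
by apply: eq_bigr => a _; rewrite (gcomp_unique grM dx).
Qed.

Lemma tcBl g y : zmod_morphism (tc g ^~ y).
Proof.
move=> x x' /=.
have [r [_ _ dx dx']] := dec_common (gcomp_dec grM x) (gcomp_dec grM x').
rewrite (tc_dec g y (decB grM dx dx')) (tc_dec g y dx) (tc_dec g y dx') -sumrB.
by apply: eq_bigr => a _; rewrite tmkBl.
Qed.

Lemma tcBr g x : zmod_morphism (tc g x).
Proof.
move=> y y'; rewrite /tc -sumrB; apply: eq_bigr => a _.
by rewrite gcompB tmkBr.
Qed.

Lemma tc_homog g a x y : mpart M a x -> tc g x y = x ⊗ gcomp grN (g - a) y.
Proof. by move=> /(dec_homog grM)/tc_dec ->; rewrite big_seq1 eqxx. Qed.

Lemma zmod_morphismD (A B : zmodType) (F : A -> B) :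
  zmod_morphism F -> {morph F : x y / x + y}.
Proof.
move=> FB x y.
have F0 : F 0 = 0 by rewrite -[X in F X](subrr 0) FB subrr.
have FN z : F (- z) = - F z by rewrite -[- z]sub0r FB F0 sub0r.
by rewrite -{1}[y]opprK FB FN opprK.
Qed.

Lemma tcZ g r x y : tc g (r *: x) y = tc g x (r *: y).
Proof.
apply: (homog_ext (rpart_grading R) (F := fun r => tc g (r *: x) y)
  (F' := fun r => tc g x (r *: y))) r.
- by move=> r r'; rewrite scalerBl tcBl.
- by move=> r r'; rewrite scalerBl tcBr.
move=> d r Rr.
apply: (homog_ext grM (F := fun x => tc g (r *: x) y)
  (F' := fun x => tc g x (r *: y))) x.
- by move=> x x'; rewrite scalerBr tcBl.
- by move=> x x'; rewrite tcBl.
move=> a x Mx.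
apply: (homog_ext grN (F := fun y => tc g (r *: x) y)
  (F' := fun y => tc g x (r *: y))) y.
- by move=> y y'; rewrite tcBr.
- by move=> y y'; rewrite scalerBr tcBr.
move=> b y Ny; rewrite (tc_homog _ _ (mpartZ Rr Mx)) (tc_homog _ _ Mx).
rewrite (gcomp_homog grN _ Ny) (gcomp_homog grN _ (mpartZ Rr Ny)).
have -> : (g - (d + a) == b) = (g - a == d + b).
  by rewrite !subr_eq addrA [b + d]addrC.
by case: eqP; rewrite ?tmk0r // (balZ tb).
Qed.

Lemma tc_balanced g : balanced (tc g).
Proof.
split; last exact: tcZ.
- by move=> x x' y; exact: zmod_morphismD (tcBl g y) x x'.
- by move=> x y y'; exact: zmod_morphismD (tcBr g x) y y'.
Qed.

Definition tcomp (g : G) : tens M N -> tens M N := tlift (tc g).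

Lemma tcompB g : zmod_morphism (tcomp g).
Proof. exact/tliftB/tc_balanced. Qed.
HB.instance Definition _ g :=
  GRing.isZmodMorphism.Build (tens M N) (tens M N) (tcomp g) (tcompB g).

Lemma tcomp_homog g d t : tens_part d t -> tcomp g t = if g == d then t else 0.
Proof.
case=> s [Ps ->]; rewrite raddf_sum /=.
transitivity (\sum_(p <- s) if g == d then p.1 ⊗ p.2 else 0 : tens M N).
  rewrite [LHS]big_seq [RHS]big_seq; apply: eq_bigr => p /Ps [a [b [Mp Np ab]]].
  rewrite /tcomp tlift_tmk; last exact: tc_balanced.
  rewrite (tc_homog _ _ Mp) (gcomp_homog grN _ Np) -ab subr_eq [b + a]addrC.
  by case: eqP; rewrite ?tmk0r.
by case: eqP => // _; rewrite big1.
Qed.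

Lemma tens_grading : is_grading tens_part.
Proof.
have subT := tens_part_subgroup.
split=> // [|s f us Pf sum0 g gs].
- apply: tens_ind => [|t u Pt Pu|x y]; first exact: sum_of0.
    exact: sum_ofB.
  have [s [f [Pf ->]]] := grading_span grM x.
  have [s' [f' [Pf' ->]]] := grading_span grN y.
  have -> : (\sum_(g <- s) f g) ⊗ (\sum_(g <- s') f' g) =
      \sum_(g <- s) \sum_(g' <- s') f g ⊗ f' g' :> tens M N.
    rewrite (big_morph (fun x => x ⊗ (\sum_(g <- s') f' g))
      (fun x x' => balDl tb x x' _) (tmk0l _)).
    apply: eq_bigr => g _.
    by rewrite (big_morph (fun y => f g ⊗ y) (balDr tb (f g)) (tmk0r _)).
  apply: sum_of_sum => // g; apply: sum_of_sum => // g'.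
  exact: (sum_of_homog subT (tens_part_tmk (Pf g) (Pf' g') erefl)).
- have := congr1 (tcomp g) sum0; rewrite raddf0 raddf_sum /=.
  rewrite (bigD1_seq g) //= (tcomp_homog _ (Pf g)) eqxx big1 ?addr0 //.
  by move=> d dg; rewrite (tcomp_homog _ (Pf d)) eq_sym (negbTE dg).
Qed.

Lemma tens_partZ g g' (a : R) (t : tens M N) :
  rpart R g a -> tens_part g' t -> tens_part (g + g') (a *: t).
Proof.
move=> Ra [s [Ps ->]]; exists [seq (a *: p.1, p.2) | p <- s]; split=> [p|].
  move=> /mapP[q /Ps [d [b [Mq Nq db]]] ->]; exists (g + d), b.
  by split=> //=; [exact: mpartZ | rewrite -addrA db].
by rewrite big_map scaler_sumr; apply: eq_bigr => p _; rewrite scale_tmk.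
Qed.

Definition gtens : gradedModule R :=
  @GradedModule G R (tens M N : lmodType R) tens_part tens_grading tens_partZ.

End Tensor.

Section TensorMap.
Variables (M M' N N' : gradedModule R).
Variables (u : gradedMor M M') (v : gradedMor N N').

Lemma tmap_deg g (t : tens M N) :
  tens_part g t -> tens_part g (tmap u v t).
Proof.
case=> s [Ps ->]; exists [seq (u p.1, v p.2) | p <- s]; split=> [p|].
  move=> /mapP[q /Ps [a [b [Mq Nq ab]]] ->]; exists a, b.
  by split=> //; exact: gmor_deg.
by rewrite raddf_sum big_map; apply: eq_bigr => p _; rewrite /= tmapE.
Qed.

Definition gtens_map : gradedMor (gtens M N) (gtens M' N') :=
  @GradedMor G R (gtens M N) (gtens M' N') (tmap u v) tmap_deg.

End TensorMap.

Definition gid M : gradedMor M M :=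
  @GradedMor G R M M idfun (fun g x Mx => Mx).

Definition is_pure M N (u : gradedMor M N) : Prop :=
  forall P : gradedModule R, is_mono (gtens_map u (gid P)).

Section Hom.
Variables M N : gradedModule R.

(* the R-linear maps that are morphisms of graded modules M -> N(g) *)
Definition hom_part (g : G) (u : M -> N) : Prop :=
  exists v : gradedMor M (shift N g), u = v.

Definition hom_pred : {pred M -> N} := fun u => `[< sum_of hom_part u >].

Lemma hom_part_subgroup : subgroup_family hom_part.
Proof.
split=> [g|g _ _ [u ->] [v ->]].
- have deg d x : mpart M d x -> mpart (shift N g) d ((\0 : M -> N) x).
    by move=> _; exact: part0 (mpart_grading N) _.
  by exists (@GradedMor G R M (shift N g) (\0 : {linear M -> N}) deg).
- have deg d x : mpart M d x ->
      mpart (shift N g) d (((u : M -> N) \- (v : M -> N)) x).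
    move=> Mx; apply: (partB (mpart_grading N));
    by [exact: (gmor_deg u) | exact: (gmor_deg v)].
  by exists (@GradedMor G R M (shift N g)
    ((u : {linear M -> N}) \- (v : {linear M -> N})) deg).
Qed.

Lemma hom_partZ_pre (g d : G) (a : R) (u : M -> N) :
  rpart R d a -> hom_part g u -> hom_part (d + g) (a *: u).
Proof.
move=> Ra [v ->].
have deg e x : mpart M e x ->
    mpart (shift N (d + g)) e ((a \*: (v : M -> N)) x).
  move=> Mx; rewrite /= /shift_part -addrA; apply: mpartZ => //.
  exact: (gmor_deg v).
by exists (@GradedMor G R M (shift N (d + g))
  (a \*: (v : {linear M -> N})) deg).
Qed.

Fact hom_submod_closed : submod_closed hom_pred.
Proof.
have sH := hom_part_subgroup.
split=> [|a u v /asboolP Hu /asboolP Hv]; first exact/asboolP/sum_of0.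
apply/asboolP; apply: sum_ofD => //.
have [s [f [Pf ->]]] := grading_span (rpart_grading R) a.
have [s' [f' [Pf' ->]]] := Hu.
rewrite scaler_suml; apply: sum_of_sum => // d.
rewrite scaler_sumr; apply: sum_of_sum => // g.
exact/(sum_of_homog sH)/(hom_partZ_pre (Pf d) (Pf' g)).
Qed.
HB.instance Definition _ := GRing.isSubmodClosed.Build R (M -> N) hom_pred
  hom_submod_closed.

(* Hom^G_R(M, N) = (+)_g Hom_(Mod^G(R))(M, N(g)), formed inside the R-module
   of all maps M -> N: the sum is direct (ghom_grading). *)
Record homG := HomG { hom_fun :> M -> N; hom_funP : hom_fun \in hom_pred }.
HB.instance Definition _ := [isSub for hom_fun].
HB.instance Definition _ := [Choice of homG by <:].
HB.instance Definition _ := [SubChoice_isSubLmodule of homG by <:].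

Definition ghom_part (g : G) (u : homG) : Prop := hom_part g u.

Lemma hom_funB (u v : homG) (x : M) : (u - v : homG) x = u x - v x.
Proof. by []. Qed.

Lemma hom_sumE (I : Type) (s : seq I) (f : I -> homG) (x : M) :
  (\sum_(i <- s) f i : homG) x = \sum_(i <- s) f i x.
Proof. by elim/big_rec2: _ => //= i y z _ <-. Qed.

Lemma hom_additive (u : homG) : zmod_morphism u.
Proof.
have [s [f [Pf ->]]] : sum_of hom_part u by exact/asboolP/hom_funP.
move=> x y; rewrite !fct_sumE -sumrB; apply: eq_bigr => g _.
by have [v ->] := Pf g; exact: raddfB.
Qed.

Lemma hom_scalable (u : homG) : scalable u.
Proof.
have [s [f [Pf ->]]] : sum_of hom_part u by exact/asboolP/hom_funP.
move=> a x; rewrite !fct_sumE scaler_sumr; apply: eq_bigr => g _.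
have [v ->] := Pf g; exact: (linearZ_LR v).
Qed.

Lemma ghom_grading : is_grading ghom_part.
Proof.
have sH := hom_part_subgroup.
have sG : subgroup_family ghom_part.
  by split=> [g|g u v]; [exact: part0 sH g | exact: partB sH g _ _].
split=> // [u|s f us Pf sum0 g gs].
- have [s [f [Pf uE]]] : sum_of hom_part u by exact/asboolP/hom_funP.
  have Hf g : f g \in hom_pred by exact/asboolP/(sum_of_homog sH (Pf g)).
  exists s, (fun g => HomG (Hf g)); split=> //.
  by apply/val_inj/funext => x /=; rewrite uE fct_sumE hom_sumE.
- apply/val_inj/funext.
  apply: (homog_ext (mpart_grading M)).
  + exact: hom_additive.
  + exact: hom_additive 0.
  move=> d x Mx; rewrite [RHS]/=.
  apply: (@grading_free _ _ _ (mpart_grading (shift N d)) s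
    (fun g => f g x) us _ _ g gs).
  + move=> e; have [v fv] := Pf e; rewrite fv /= /shift_part addrC.
    exact: (gmor_deg v).
  + by rewrite -hom_sumE sum0.
Qed.

Lemma ghom_partZ g g' (a : R) (u : homG) :
  rpart R g a -> ghom_part g' u -> ghom_part (g + g') (a *: u).
Proof. exact: hom_partZ_pre. Qed.

Definition ghom : gradedModule R :=
  @GradedModule G R (homG : lmodType R) ghom_part ghom_grading ghom_partZ.

End Hom.
End Category.

Section ChangeOfRings.
Variables (G : zmodType) (R S : gradedRing G) (h : gradedRingMor R S).

Section Restriction.
Variable M : gradedModule S.

Definition restr_type : Type := M.
HB.instance Definition _ := GRing.Zmodule.on restr_type.

Definition restr_scale (a : R) (x : restr_type) : restr_type :=
  h a *: (x : M).

Fact restr_scaleA a b x :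
  restr_scale a (restr_scale b x) = restr_scale (a * b) x.
Proof. by rewrite /restr_scale scalerA rmorphM. Qed.

Fact restr_scale1 : left_id 1 restr_scale.
Proof. by move=> x; rewrite /restr_scale rmorph1 scale1r. Qed.

Fact restr_scaleDr : right_distributive restr_scale +%R.
Proof. by move=> a x y; exact: scalerDr. Qed.

Fact restr_scaleDl x : {morph restr_scale^~ x : a b / a + b}.
Proof. by move=> a b; rewrite /restr_scale rmorphD; exact: scalerDl. Qed.

HB.instance Definition _ := GRing.Zmodule_isLmodule.Build R restr_type
  restr_scaleA restr_scale1 restr_scaleDr restr_scaleDl.

Lemma restr_partZ g g' (a : R) (x : restr_type) :
  rpart R g a -> mpart M g' x -> mpart M (g + g') (a *: x : restr_type).
Proof. by move=> Ra; apply: mpartZ; exact: grm_deg. Qed.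

(* h_* M *)
Definition restr : gradedModule R :=
  @GradedModule G R (restr_type : lmodType R) (mpart M) (mpart_grading M)
    restr_partZ.

End Restriction.

(* h as a morphism R -> h_* S of graded R-modules *)
Definition under_fun (a : regular R) : restr (regular S) := h a.

Fact under_linear : linear under_fun.
Proof. by move=> a x y; rewrite /under_fun rmorphD rmorphM. Qed.
HB.instance Definition _ :=
  GRing.isLinear.Build R (regular R) (restr (regular S)) *:%R under_fun
    under_linear.

Definition under : gradedMor (regular R) (restr (regular S)) :=
  @GradedMor G R (regular R) (restr (regular S)) under_fun (grm_deg h).

Section Extension.
Variable M : gradedModule R.

Definition ext_type : Type := tens (restr (regular S)) M.
HB.instance Definition _ := GRing.Zmodule.on ext_type.

Lemma ext_scale_balanced (s : S) :
  balanced (fun (t : restr (regular S)) (x : M) =>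
    ((s * (t : S) : restr (regular S)) ⊗ x : ext_type)).
Proof.
have [Dl Dr Z] := tmk_balanced (restr (regular S)) M.
split=> [t t' x|t x x'|a t x]; first by rewrite -Dl -mulrDr.
- exact: Dr.
- rewrite -Z; congr tmk.
  by rewrite -[RHS]/(h a * (s * (t : S))) mulrCA.
Qed.

(* the S-action on S (x)_R M: s (t (x) x) = (s t) (x) x *)
Definition ext_scale (s : S) : ext_type -> ext_type :=
  tlift (fun (t : restr (regular S)) (x : M) =>
    ((s * (t : S) : restr (regular S)) ⊗ x : ext_type)).

Lemma ext_scaleE (s : S) (t : restr (regular S)) (x : M) :
  ext_scale s (t ⊗ x) = (s * (t : S) : restr (regular S)) ⊗ x.
Proof. exact/tlift_tmk/ext_scale_balanced. Qed.

Lemma ext_scaleDr : right_distributive ext_scale +%R.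
Proof. by move=> s; exact/tliftD/ext_scale_balanced. Qed.

Lemma ext_scaleBr s : zmod_morphism (ext_scale s).
Proof. exact/tliftB/ext_scale_balanced. Qed.

Fact ext_scaleA a b t : ext_scale a (ext_scale b t) = ext_scale (a * b) t.
Proof.
apply: (tens_ext (F := ext_scale a \o ext_scale b)
  (F' := ext_scale (a * b))) t.
- by move=> t u /=; rewrite !ext_scaleBr.
- exact: ext_scaleBr.
- by move=> x y /=; rewrite !ext_scaleE mulrA.
Qed.

Fact ext_scale1 : left_id 1 ext_scale.
Proof.
apply: (tens_ext (F' := idfun)) => //; first exact: ext_scaleBr.
by move=> x y /=; rewrite ext_scaleE mul1r.
Qed.

Fact ext_scaleDl t : {morph ext_scale^~ t : a b / a + b}.
Proof.
move=> a b /=.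
apply: (tens_ext (F' := fun u => ext_scale a u + ext_scale b u)) t => /=.
- exact: ext_scaleBr.
- by move=> t u; rewrite !ext_scaleBr opprD addrACA.
- move=> x y; rewrite !ext_scaleE mulrDl.
  exact: (balDl (tmk_balanced (restr (regular S)) M)).
Qed.

HB.instance Definition _ := GRing.Zmodule_isLmodule.Build S ext_type
  ext_scaleA ext_scale1 ext_scaleDr ext_scaleDl.

Lemma ext_partZ g g' (s : S) (t : ext_type) :
  rpart S g s -> tens_part g' t -> tens_part (g + g') (s *: t : ext_type).
Proof.
move=> Ss [l [Pl ->]].
exists [seq ((s * (p.1 : S) : restr (regular S)), p.2) | p <- l]; split=> [p|].
  move=> /mapP[q /Pl [d [b [Mq Nq db]]] ->]; exists (g + d), b.
  by split=> //=; [exact: rpartM | rewrite -addrA db].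
rewrite big_map; transitivity
  (\sum_(p <- l) (s *: (p.1 ⊗ p.2 : ext_type) : ext_type)).
  exact: (@scaler_sumr S ext_type).
by apply: eq_bigr => p _; exact: ext_scaleE.
Qed.

(* h^* M *)
Definition ext : gradedModule S :=
  @GradedModule G S (ext_type : lmodType S)
    (@tens_part G R (restr (regular S)) M)
    (tens_grading (restr (regular S)) M) ext_partZ.

(* rho^h_M : M -> h_* h^* M *)
Definition rho_fun (x : M) : restr ext := ((1 : S) : restr (regular S)) ⊗ x.

Fact rho_linear : linear rho_fun.
Proof.
have [Dl Dr Z] := tmk_balanced (restr (regular S)) M.
move=> a x y; rewrite /rho_fun Dr; congr (_ + _).
by rewrite -Z; symmetry; exact: ext_scaleE.
Qed.
HB.instance Definition _ :=
  GRing.isLinear.Build R M (restr ext) *:%R rho_fun rho_linear.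

Lemma rho_deg g x : mpart M g x -> mpart (restr ext) g (rho_fun x).
Proof. by move=> Mx; apply: tens_part_tmk (add0r g) => //; exact: rpart1. Qed.

Definition rho : gradedMor M (restr ext) :=
  @GradedMor G R M (restr ext) rho_fun rho_deg.

End Extension.

Section Coextension.
Variable M : gradedModule R.

Definition coext_type : Type := homG (restr (regular S)) M.
HB.instance Definition _ := GRing.Zmodule.on coext_type.

Lemma hom_part_mul (d g : G) (s : S) (u : restr (regular S) -> M) :
  rpart S d s -> hom_part g u ->
  hom_part (d + g) (fun t : restr (regular S) => u (s * (t : S))).
Proof.
move=> Ss [v ->].
pose w (t : restr (regular S)) : shift M (d + g) := v (s * (t : S)).
have wl : linear w.
  move=> a x y.
  have wE : s * (a *: x + y : restr (regular S)) =
      (a *: (s * (x : S) : restr (regular S)) + (s * (y : S))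
        : restr (regular S)) :> S.
    by rewrite mulrDr; congr (_ + _); exact: (mulrCA s (h a) x).
  by rewrite /w wE; exact: (linearP v a (s * (x : S) : restr (regular S))).
pose H := GRing.isLinear.Build R (restr (regular S)) (shift M (d + g)) *:%R w wl.
pose wf : {linear restr (regular S) -> shift M (d + g)} := HB.pack w H.
have deg e t : mpart (restr (regular S)) e t -> mpart (shift M (d + g)) e (wf t).
  move=> St; rewrite /= /shift_part [d + g]addrC -addrA.
  by apply: (gmor_deg v); exact: rpartM.
by exists (GradedMor deg).
Qed.

Fact coext_scale_subproof (s : S) (u : coext_type) :
  (fun t : restr (regular S) => (u : homG _ _) (s * (t : S)))
    \in @hom_pred G R (restr (regular S)) M.
Proof.
have sH := hom_part_subgroup (restr (regular S)) M.
apply/asboolP.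
have [l [f [Pf ->]]] := grading_span (rpart_grading S) s.
have [l' [f' [Pf' uE]]] : sum_of (@hom_part _ _ (restr (regular S)) M) u.
  by apply/asboolP; exact: (hom_funP u).
have -> : (fun t : restr (regular S) =>
      (u : homG _ _) ((\sum_(d <- l) f d) * (t : S))) =
    \sum_(d <- l) \sum_(g <- l')
      (fun t : restr (regular S) => f' g (f d * (t : S))).
  apply/funext => t; rewrite mulr_suml.
  pose H := GRing.isZmodMorphism.Build (restr (regular S)) M
    (u : homG (restr (regular S)) M) (@hom_additive _ _ _ _ u).
  pose ua : {additive restr (regular S) -> M} :=
    HB.pack ((u : homG (restr (regular S)) M) : restr (regular S) -> M) H.
  rewrite -[LHS]/(ua _) (raddf_sum ua) fct_sumE; apply: eq_bigr => d _.
  by rewrite -[LHS]/((u : homG _ _) _) uE !fct_sumE.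
apply: sum_of_sum => // d; apply: sum_of_sum => // g.
exact/(sum_of_homog sH)/(hom_part_mul (Pf d) (Pf' g)).
Qed.

(* the S-action on Hom^G_R(h_* S, M): (s u)(t) = u (s t) *)
Definition coext_scale (s : S) (u : coext_type) : coext_type :=
  HomG (coext_scale_subproof s u).

Fact coext_scaleA a b u : coext_scale a (coext_scale b u) = coext_scale (a * b) u.
Proof.
apply/val_inj/funext => t /=; congr (hom_fun u _).
by rewrite mulrA [b * a]mulrC.
Qed.

Fact coext_scale1 : left_id 1 coext_scale.
Proof. by move=> u; apply/val_inj/funext => t /=; rewrite mul1r. Qed.

Fact coext_scaleDr : right_distributive coext_scale +%R.
Proof. by move=> s u v; exact/val_inj/funext. Qed.

Fact coext_scaleDl u : {morph coext_scale^~ u : a b / a + b}.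
Proof.
move=> a b; apply/val_inj/funext => t /=; rewrite mulrDl.
exact: (zmod_morphismD (@hom_additive _ _ _ _ (u : homG _ _))).
Qed.

HB.instance Definition _ := GRing.Zmodule_isLmodule.Build S coext_type
  coext_scaleA coext_scale1 coext_scaleDr coext_scaleDl.

Lemma coext_partZ g g' (s : S) (u : coext_type) :
  rpart S g s -> ghom_part g' u -> ghom_part (g + g') (s *: u : coext_type).
Proof. exact: hom_part_mul. Qed.

(* h~ M *)
Definition coext : gradedModule S :=
  @GradedModule G S (coext_type : lmodType S)
    (@ghom_part G R (restr (regular S)) M)
    (ghom_grading (restr (regular S)) M) coext_partZ.

(* sigma~^h_M : h_* h~ M -> M *)
Definition sigma_fun (u : restr coext) : M :=
  (u : homG (restr (regular S)) M) (1 : S).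

Fact sigma_linear : linear sigma_fun.
Proof.
move=> a u v; rewrite /sigma_fun; congr (_ + _).
transitivity ((u : homG (restr (regular S)) M)
  (a *: ((1 : S) : restr (regular S)))); first by [].
exact: hom_scalable.
Qed.
HB.instance Definition _ :=
  GRing.isLinear.Build R (restr coext) M *:%R sigma_fun sigma_linear.

Lemma sigma_deg g u : mpart (restr coext) g u -> mpart M g (sigma_fun u).
Proof.
case=> v uE; rewrite /sigma_fun [X in mpart M g X](congr1 (@^~ (1 : S)) uE).
have := gmor_deg v (rpart1 S); rewrite /= /shift_part.
by rewrite (_ : g + 0 = g) // addr0.
Qed.

Definition sigma : gradedMor (restr coext) M :=
  @GradedMor G R (restr coext) M sigma_fun sigma_deg.

End Coextension.

End ChangeOfRings.

(* Main.v *)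
Require Import Defs.
From mathcomp Require Import all_boot all_algebra.
From HB Require Import structures.
From mathcomp Require Import boolp.

(* Evaluating at a homogeneous x of degree g turns a morphism on h_* h^* M into
   a morphism s |-> v (s (x) x) from h_* S to a shift K(g), and an element of
   degree g of h~ M is by definition a morphism h_* S -> M(g); since h (a) =
   a 1_S, two such morphisms agree at 1_S iff they agree on the image of h.
   This yields "h epi => rho epi" and "sigma~ mono <=> h epi" without describing
   epimorphisms.  Purity is handled through M = R (x) M, and a retraction v of h
   gives a retraction s (x) x |-> v (s) x of rho and preimages s |-> v (s) x
   under sigma~.  The remaining implications are read off at M = R: they use
   that monomorphisms are injective (test on shifts of R) and epimorphisms
   surjective (test on the cokernel); the degree 0 component of a u with
   u (1_S) = 1_R is the required retraction of h. *)

Set Implicit Arguments.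
Unset Strict Implicit.
Unset Printing Implicit Defensive.

Import GRing.Theory.
Local Open Scope ring_scope.
Local Open Scope quotient_scope.

(** * Monomorphisms, epimorphisms and isomorphisms of graded modules *)

Section GradedCategory.
Variables (G : zmodType) (R : gradedRing G).
Implicit Types M N K : gradedModule R.

Definition linear_mor M N (f : M -> N) (f_lin : linear f)
    (f_deg : forall g x, mpart M g x -> mpart N g (f x)) : gradedMor M N :=
  @GradedMor G R M N
    (HB.pack f (GRing.isLinear.Build R M N *:%R f f_lin) : {linear M -> N})
    f_deg.

Lemma gmor_ext M N (v w : gradedMor M N) :
  (forall g x, mpart M g x -> v x = w x) -> v =1 w.
Proof.
by move=> vw; apply: (homog_ext (mpart_grading M)) => //; exact: raddfB.
Qed.

Lemma gcomp0 M g : gcomp (mpart_grading M) g 0 = 0.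
Proof. by rewrite (gcomp_homog _ _ (part0 (mpart_grading M) g)) if_same. Qed.

(** The images under [u] of the components of [x] decompose [u x], and decompositions are unique.
    Kernels and images are therefore graded. *)
Lemma gmor_gcomp M N (u : gradedMor M N) g x :
  u (gcomp (mpart_grading M) g x) = gcomp (mpart_grading N) g (u x).
Proof.
have [us Mf f0 xE] := gcomp_dec (mpart_grading M) x; apply/esym.
apply: (@gcomp_unique _ _ _ (mpart_grading N) _ (gsupp (mpart_grading M) x)
  (fun d => u (gcomp (mpart_grading M) d x))); split=> // [d|d /f0 ->|].
- exact: gmor_deg.
- by rewrite linear0.
- by rewrite {1}xE raddf_sum.
Qed.

(** R(-g) is free on 1 placed in degree g, so [x] yields the morphism a |-> a x from it, whose
    composite with [u] is zero. *)
Lemma mono_homog_eq0 M N (u : gradedMor M N) g x :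
  is_mono u -> mpart M g x -> u x = 0 -> x = 0.
Proof.
move=> mono_u Mx ux0.
pose P := shift (regular R) (- g).
pose f (a : P) : M := (a : R) *: x.
have f_lin : linear f by move=> a b c; rewrite /f scalerDl -scalerA.
have f_deg d a : mpart P d a -> mpart M d (f a).
  by move=> Pa; have := mpartZ Pa Mx; rewrite addrAC addNr add0r.
pose z (a : P) : M := 0.
have z_lin : linear z by move=> a b c; rewrite /z scaler0 addr0.
have z_deg d a : mpart P d a -> mpart M d (z a).
  by move=> _; exact: part0 (mpart_grading M) d.
rewrite -[x]scale1r.
apply: (mono_u _ (linear_mor f_lin f_deg) (linear_mor z_lin z_deg)) => a /=.
by rewrite /f /z linearZ_LR ux0 scaler0 linear0.
Qed.

(** The kernel contains the components of its elements, so testing homogeneous elements suffices. *)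
Lemma is_mono_inj M N (u : gradedMor M N) : is_mono u -> injective u.
Proof.
move=> mono_u x y /eqP; rewrite -subr_eq0 -linearB => /eqP ux0.
apply/eqP; rewrite -subr_eq0; apply/eqP; move: (x - y) ux0 => {x y} x ux0.
have [_ Mf _ ->] := gcomp_dec (mpart_grading M) x.
rewrite big1 // => g _; apply: (mono_homog_eq0 mono_u (Mf g)).
by rewrite gmor_gcomp ux0 gcomp0.
Qed.

Lemma inj_is_mono M N (u : gradedMor M N) : injective u -> is_mono u.
Proof. by move=> inj_u K v w uvw x; exact/inj_u/uvw. Qed.

(** * Graded cokernels and surjectivity of epimorphisms *)

Section Cokernel.
Variables (M N : gradedModule R) (u : gradedMor M N).

Definition gim : {pred N} := fun y => `[< exists x, y = u x >].

Fact gim_zmod_closed : zmod_closed gim.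
Proof.
split; first by apply/asboolP; exists 0; rewrite linear0.
by move=> _ _ /asboolP[x ->] /asboolP[y ->]; apply/asboolP; exists (x - y);
   rewrite linearB.
Qed.
HB.instance Definition _ := GRing.isZmodClosed.Build _ gim gim_zmod_closed.

Definition gim_subgroup : zmodClosed N := GRing.ZmodClosed.clone _ gim _.

Definition coker : Type := Quotient.quot gim_subgroup.
HB.instance Definition _ := GRing.Zmodule.on coker.

Definition coker_pi (y : N) : coker := \pi_(Quotient.quot gim_subgroup) y.

Lemma coker_piB : zmod_morphism coker_pi.
Proof. by move=> x y; rewrite /coker_pi !piE. Qed.
HB.instance Definition _ :=
  GRing.isZmodMorphism.Build N coker coker_pi coker_piB.

Lemma coker_pi_eq y y' : coker_pi y = coker_pi y' <-> exists x, y - y' = u x.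
Proof.
split=> [/eqP|[x yE]].
  by rewrite /coker_pi -Quotient.idealrBE => /asboolP.
by apply/eqP; rewrite /coker_pi -Quotient.idealrBE; apply/asboolP; exists x.
Qed.

Lemma coker_pi_surj (q : coker) : exists y, q = coker_pi y.
Proof. by elim/quotW: q => y; exists y. Qed.

(** Defined through a chosen representative; [coker_scaleE] shows that the choice is immaterial. *)
Definition coker_scale (a : R) (q : coker) : coker :=
  coker_pi (a *: repr (q : Quotient.quot gim_subgroup)).

Lemma coker_scaleE a y : coker_scale a (coker_pi y) = coker_pi (a *: y).
Proof.
have : coker_pi (repr (coker_pi y : Quotient.quot gim_subgroup)) = coker_pi y.
  exact: reprK.
move=> /coker_pi_eq[x xE]; apply/coker_pi_eq; exists (a *: x).
by rewrite -scalerBr linearZ_LR; congr (_ *: _).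
Qed.

Fact coker_scaleA a b q :
  coker_scale a (coker_scale b q) = coker_scale (a * b) q.
Proof. by have [y ->] := coker_pi_surj q; rewrite !coker_scaleE scalerA. Qed.

Fact coker_scale1 : left_id 1 coker_scale.
Proof.
by move=> q; have [y ->] := coker_pi_surj q; rewrite coker_scaleE scale1r.
Qed.

Fact coker_scaleDr : right_distributive coker_scale +%R.
Proof.
move=> a p q; have [y ->] := coker_pi_surj p; have [z ->] := coker_pi_surj q.
by rewrite -raddfD !coker_scaleE -raddfD scalerDr.
Qed.

Fact coker_scaleDl q : {morph coker_scale^~ q : a b / a + b}.
Proof.
move=> a b; have [y ->] := coker_pi_surj q.
by rewrite !coker_scaleE -raddfD scalerDl.
Qed.

HB.instance Definition _ := GRing.Zmodule_isLmodule.Build R coker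
  coker_scaleA coker_scale1 coker_scaleDr coker_scaleDl.

Definition coker_part g (q : coker) : Prop :=
  exists2 y, mpart N g y & q = coker_pi y.

Fact coker_grading : is_grading coker_part.
Proof.
pose grN := mpart_grading N; pose grM := mpart_grading M.
split=> [|q|s f us Pf sum0 g gs].
- split=> [g|g _ _ [y Ny ->] [z Nz ->]].
    by exists 0; [exact: part0 grN g | rewrite raddf0].
  by exists (y - z); [exact: (partB grN) | rewrite raddfB].
- have [y ->] := coker_pi_surj q; have [s [f [Nf ->]]] := grading_span grN y.
  exists s, (fun g => coker_pi (f g)); split=> [g|]; last exact: raddf_sum.
  by exists (f g).
(* The homogeneous lifts [y d] sum to some [u x]; its component of degree g is [y g], which is thus
   the image of the component of [x]. *)
have /boolp.choice[y yP] d : exists y, mpart N d y /\ f d = coker_pi y.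
  by have [y] := Pf d; exists y.
have : coker_pi (\sum_(d <- s) y d) = coker_pi 0.
  rewrite raddf_sum raddf0 -[RHS]sum0.
  by apply: eq_bigr => d _; have [_ ->] := yP d.
move=> /coker_pi_eq[x]; rewrite subr0 => xE.
have [Ny ->] := yP g; rewrite -(raddf0 coker_pi); apply/coker_pi_eq.
exists (gcomp grM g x); rewrite subr0.
have ycE : gcomp grN g (\sum_(d <- s) y d) = y g.
  (* [dec] asks for a family vanishing outside [s], where the lifts may be nonzero. *)
  pose y' d := if d \in s then y d else 0.
  rewrite (@gcomp_unique _ _ _ grN _ s y') /y' ?gs //; split=> //.
  - by move=> d; case: ifP => _; [have [] := yP d | exact: part0 grN d].
  - by move=> d /negbTE ->.
  - by rewrite [LHS]big_seq [RHS]big_seq; apply: eq_bigr => d ->.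
by rewrite -ycE xE gmor_gcomp.
Qed.

Fact coker_partZ g g' (a : R) (q : coker) :
  rpart R g a -> coker_part g' q -> coker_part (g + g') (a *: q).
Proof.
move=> Ra [y Ny ->]; exists (a *: y); first exact: mpartZ.
exact: coker_scaleE.
Qed.

Definition gcoker : gradedModule R :=
  @GradedModule G R (coker : lmodType R) coker_part coker_grading coker_partZ.

(** The projection to the cokernel and the zero map agree after [u], hence everywhere. *)
Lemma is_epi_surj : is_epi u -> forall y, exists x, y = u x.
Proof.
move=> epi_u y.
have p_lin : linear (coker_pi : N -> gcoker).
  by move=> a x z; rewrite raddfD; congr (_ + _); exact/esym/coker_scaleE.
have p_deg g x : mpart N g x -> mpart gcoker g (coker_pi x) by exists x.
have z_lin : linear (fun _ : N => 0 : gcoker).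
  by move=> a x z; rewrite scaler0 addr0.
have z_deg g x : mpart N g x -> mpart gcoker g (0 : gcoker).
  by move=> _; exact: part0 (mpart_grading gcoker) g.
have /coker_pi_eq[x xE] : coker_pi y = coker_pi 0.
  rewrite raddf0.
  apply: (epi_u _ (linear_mor p_lin p_deg) (linear_mor z_lin z_deg)) => x /=.
  rewrite -(raddf0 coker_pi); apply/coker_pi_eq.
  by exists x; rewrite subr0.
by exists x; rewrite -xE subr0.
Qed.

End Cokernel.

Lemma surj_is_epi M N (u : gradedMor M N) :
  (forall y, exists x, y = u x) -> is_epi u.
Proof. by move=> surj_u K v w vw y; have [x ->] := surj_u y; exact: vw. Qed.

Lemma iso_section M N (u : gradedMor M N) : is_iso u -> is_section u.
Proof. by case=> v [vu _]; exists v. Qed.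

Lemma section_mono M N (u : gradedMor M N) : is_section u -> is_mono u.
Proof. by case=> v vu; exact: inj_is_mono (can_inj (g := v) vu). Qed.

Lemma iso_mono M N (u : gradedMor M N) : is_iso u -> is_mono u.
Proof. by move=> /iso_section/section_mono. Qed.

Lemma iso_epi M N (u : gradedMor M N) : is_iso u -> is_epi u.
Proof.
by case=> v [_ uv]; apply: surj_is_epi => y; exists (v y); exact/esym/uv.
Qed.

(** The inverse map is linear by injectivity of [u], and preserves degrees because [u] commutes with
    components. *)
Lemma mono_epi_iso M N (u : gradedMor M N) :
  is_mono u -> is_epi u -> is_iso u.
Proof.
move=> /is_mono_inj inj_u /is_epi_surj/boolp.choice[v uv].
have v_lin : linear v by move=> a x y; apply: inj_u; rewrite linearP -!uv.
have v_deg g y : mpart N g y -> mpart M g (v y).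
  move=> Ny; have [_ Mf _ _] := gcomp_dec (mpart_grading M) (v y).
  suff -> : v y = gcomp (mpart_grading M) g (v y) by exact: Mf.
  by apply: inj_u; rewrite gmor_gcomp -!uv (gcomp_homog _ _ Ny) eqxx.
exists (linear_mor v_lin v_deg); split=> [x|y]; last exact/esym/uv.
by apply: inj_u; exact/esym/uv.
Qed.

End GradedCategory.

(** * Comparison of [rho] and [sigma] with [h] *)

Section ChangeOfRings.
Variables (G : zmodType) (R S : gradedRing G) (h : gradedRingMor R S).
Local Notation RS := (restr h (regular S)).
Local Notation one := ((1 : S) : RS).

Lemma underZ (a : R) : under h a = a *: one.
Proof. by rewrite /= /under_fun -[RHS]/(h a * 1) mulr1. Qed.

Section Module.
Variable M : gradedModule R.

Lemma tens_regular_one (t : tens (regular R) M) :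
  exists x : M, t = (1 : regular R) ⊗ x.
Proof.
have [Dl Dr Z] := tmk_balanced (regular R) M.
elim/tens_ind: t => [|t u [x ->] [y ->]|a x].
- by exists 0; rewrite tmk0r.
- by exists (x - y); rewrite tmkBr.
- by exists (a *: x); rewrite -Z /= -[X in _ = X ⊗ _]/(a * 1) mulr1.
Qed.

Lemma act_balanced : balanced (fun (a : regular R) (x : M) => (a : R) *: x).
Proof.
split=> [a b x|a x y|r a x]; rewrite ?scalerDl ?scalerDr //.
by rewrite scalerA mulrC.
Qed.

Lemma tmk1_inj : injective (fun x : M => (1 : regular R) ⊗ x).
Proof.
move=> x y /(congr1 (tlift (fun (a : regular R) (x : M) => (a : R) *: x))).
by rewrite !(tlift_tmk act_balanced) !scale1r.
Qed.

Lemma under_tens1 (x : M) :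
  gtens_map (under h) (gid M) ((1 : regular R) ⊗ x) = rho h M x.
Proof. by rewrite /= tmapE /under_fun rmorph1. Qed.

(** Along the bijection x |-> 1 (x) x from M to R (x) M, [rho] becomes h (x) M; letting M vary gives
    purity. *)
Lemma rho_mono_under_tens :
  is_mono (rho h M) <-> is_mono (gtens_map (under h) (gid M)).
Proof.
split=> mono_r; apply: inj_is_mono; have inj := is_mono_inj mono_r.
  move=> t t'; have [x ->] := tens_regular_one t.
  have [y ->] := tens_regular_one t'.
  by rewrite !under_tens1 => /inj ->.
by move=> x y; rewrite -!under_tens1 => /inj/tmk1_inj.
Qed.

Lemma rho_epi : is_epi (under h) -> is_epi (rho h M).
Proof.
move=> epi_h K v w vw.
have [Dl Dr Z] := tmk_balanced RS M.
apply: (tens_ext (F := v) (F' := w)); [exact: raddfB v | exact: raddfB w |].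
(* By additivity x may be taken homogeneous, which makes s |-> v (s (x) x) graded up to a shift. *)
move=> s; apply: (homog_ext (mpart_grading M) (F := fun x => v (s ⊗ x))
  (F' := fun x => w (s ⊗ x))) => [x y|x y|g x Mx].
- by rewrite tmkBr; exact: (raddfB v).
- by rewrite tmkBr; exact: (raddfB w).
pose ev (u : gradedMor (restr h (ext h M)) K) (t : RS) : shift K g :=
  u (t ⊗ x).
have ev_lin u : linear (ev u).
  move=> a t t'; rewrite /ev Dl -(linearP u); congr (u (_ + _)).
  by symmetry; exact: ext_scaleE.
have ev_deg u d t : mpart RS d t -> mpart (shift K g) d (ev u t).
  by move=> St; apply: (gmor_deg u); apply: tens_part_tmk St Mx (addrC _ _).
apply: (epi_h _ (linear_mor (ev_lin v) (@ev_deg v))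
  (linear_mor (ev_lin w) (@ev_deg w))) => a.
rewrite /comp underZ !(linearZ_LR (linear_mor (ev_lin _) _)).
by congr (_ *: _); exact: vw.
Qed.

(** This serves the isomorphism case, where [h] has a retraction. *)
Lemma rho_mono : is_section (under h) -> is_mono (rho h M).
Proof.
move=> [v vh]; apply: inj_is_mono => x y.
have f_bal : balanced (fun (s : RS) (x : M) => (v s : R) *: x).
  split=> [s t z|s z z'|r s z]; rewrite ?linearD ?scalerDl ?scalerDr //.
  by rewrite linearZ_LR scalerA mulrC.
move=> /(congr1 (tlift (fun (s : RS) (x : M) => (v s : R) *: x))).
have v1 : v one = 1 by have := vh 1; rewrite /= /under_fun rmorph1.
by rewrite /= /rho_fun !(tlift_tmk f_bal) v1 !scale1r.
Qed.

Lemma sigma_mono : is_epi (under h) -> is_mono (sigma h M).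
Proof.
move=> epi_h K v w vw; apply: gmor_ext => g x Kx.
(* [v x] and [w x] have degree g, so they are morphisms [p'] and [q'] from h_* S to M(g). *)
have [p' pE] := gmor_deg v Kx; have [q' qE] := gmor_deg w Kx.
apply/val_inj/funext => s; rewrite /= [LHS](congr1 (@^~ s) pE).
rewrite [RHS](congr1 (@^~ s) qE).
apply: (epi_h _ p' q') => a; rewrite /comp underZ !linearZ_LR; congr (_ *: _).
exact: etrans (esym (congr1 (@^~ one) pE))
  (etrans (vw x) (congr1 (@^~ one) qE)).
Qed.

Lemma sigma_epi : is_section (under h) -> is_epi (sigma h M).
Proof.
move=> [v vh] K p q pq; apply: gmor_ext => g x Mx.
pose f (s : RS) : shift M g := (v s : R) *: (x : M).
have f_lin : linear f by move=> a s t; rewrite /f linearP scalerDl -scalerA.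
have f_deg d s : mpart RS d s -> mpart (shift M g) d (f s).
  by move=> Ss; rewrite /= /shift_part addrC; exact: mpartZ (gmor_deg v Ss) Mx.
have f_hom : (f : RS -> M) \in @hom_pred G R RS M.
  apply/asboolP; apply: (sum_of_homog (hom_part_subgroup _ _) (g := g)).
  by exists (linear_mor f_lin f_deg).
have <- : sigma h M (HomG f_hom) = x; last exact: pq.
have v1 : v one = 1 by have := vh 1; rewrite /= /under_fun rmorph1.
by rewrite /= /sigma_fun /= /f v1 scale1r.
Qed.

End Module.

(** * From [rho] and [sigma] back to [h] *)

Lemma under_epi_rho : is_epi (rho h (regular R)) -> is_epi (under h).
Proof.
move=> /is_epi_surj surj_r; apply: surj_is_epi => s.
(* This induces t (x) a |-> a t; applied to s (x) 1 = 1 (x) a it gives s = a 1_S = h (a). *)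
pose f (t : RS) (a : regular R) : RS := (a : R) *: t.
have f_bal : balanced f.
  split=> [t t' a|t a b|r t a]; rewrite /f ?scalerDl ?scalerDr //.
  by rewrite scalerA mulrC.
have [a /(congr1 (tlift f))] := surj_r (s ⊗ (1 : regular R)).
rewrite /= /rho_fun !(tlift_tmk f_bal) /f scale1r => ->.
by exists a; rewrite -underZ.
Qed.

(** At M = R, [rho] factors through [h], as 1 (x) c = h (c) (x) 1. *)
Lemma under_mono_rho : is_mono (rho h (regular R)) -> is_mono (under h).
Proof.
move=> /is_mono_inj inj_r; apply: inj_is_mono => a b hab; apply: inj_r.
have rhoE c : rho h (regular R) c = (under h c) ⊗ (1 : regular R).
  rewrite underZ (balZ (tmk_balanced RS (regular R))).
  by rewrite -[X in _ = _ ⊗ X]/(c * 1) mulr1.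
by rewrite !rhoE hab.
Qed.

(** The test object K itself is taken as M: [v] and [w] are elements of degree 0 of h~ K with the
    same value at 1_S. *)
Lemma under_epi_sigma : (forall M, is_mono (sigma h M)) -> is_epi (under h).
Proof.
move=> mono_s K v w vw.
(* The parts of K(0) and K agree only up to rewriting 0 + d = d. *)
have deg0 (u : gradedMor RS K) d x : mpart RS d x -> mpart (shift K 0) d (u x).
  by move=> /(gmor_deg u); rewrite /= /shift_part add0r.
have cP (u : gradedMor RS K) : (u : RS -> K) \in @hom_pred G R RS K.
  apply/asboolP; apply: (sum_of_homog (hom_part_subgroup _ _) (g := 0)).
  by exists (linear_mor (linearP u : linear (u : RS -> shift K 0)) (@deg0 u)).
have : HomG (cP v) = HomG (cP w) :> restr h (coext h K).
  apply: (is_mono_inj (mono_s K)); have := vw 1.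
  by rewrite /= /under_fun /sigma_fun /= rmorph1.
by move=> [vwE] s; rewrite [LHS](congr1 (@^~ s) vwE).
Qed.

Lemma under_section_sigma :
  is_epi (sigma h (regular R)) -> is_section (under h).
Proof.
move=> /is_epi_surj/(_ (1 : R)) [u u1].
pose u0 := gcomp (mpart_grading (restr h (coext h (regular R)))) 0 u.
have [_ /(_ 0) [v vE] _ _] :=
  gcomp_dec (mpart_grading (restr h (coext h (regular R)))) u.
have v_deg g x : mpart RS g x -> mpart (regular R) g (v x).
  by move=> /(gmor_deg v); rewrite /= /shift_part add0r.
exists (linear_mor (linearP v : linear (v : RS -> regular R)) v_deg) => a.
rewrite /= -[LHS]/(v (under h a)) underZ linearZ_LR.
suff -> : v one = (1 : R) by exact: mulr1.
(* [sigma] commutes with components and 1_R has degree 0, so [u0] still takes the value 1_R at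
   1_S. *)
transitivity (sigma h (regular R) u0); first exact/esym/(congr1 (@^~ one) vE).
rewrite gmor_gcomp -u1.
by rewrite (gcomp_homog (mpart_grading (regular R)) 0 (rpart1 R)) eqxx.
Qed.

End ChangeOfRings.

Theorem mainTheorem5 (G : zmodType) (R S : gradedRing G)
    (h : gradedRingMor R S) :
  (((forall M : gradedModule R, is_mono (rho h M)) <-> is_pure (under h)) /\
   ((forall M : gradedModule R, is_epi (rho h M)) <-> is_epi (under h)) /\
   ((forall M : gradedModule R, is_iso (rho h M)) <-> is_iso (under h))) /\
  (((forall M : gradedModule R, is_mono (sigma h M)) <-> is_epi (under h)) /\
   ((forall M : gradedModule R, is_epi (sigma h M)) <-> is_section (under h)) /\
   ((forall M : gradedModule R, is_iso (sigma h M)) <-> is_iso (under h))).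
Proof.
split; split; [|split| |split].
- by split=> H M; exact/rho_mono_under_tens/H.
- by split=> [/(_ (regular R))/under_epi_rho|H M] //; exact: rho_epi.
- split=> [/(_ (regular R)) iso_r|iso_h M]; apply: mono_epi_iso.
  + exact/under_mono_rho/iso_mono.
  + exact/under_epi_rho/iso_epi.
  + exact/rho_mono/iso_section.
  + exact/rho_epi/iso_epi.
- by split=> [|H M]; [exact: under_epi_sigma | exact: sigma_mono].
- split=> [/(_ (regular R))/under_section_sigma //|H M].
  exact: sigma_epi.
(* The roles cross: [sigma] epi at R makes [h] a section, hence mono, while [sigma] mono at all M
   makes [h] epi. *)
- split=> [iso_s|iso_h M]; apply: mono_epi_iso.
  + exact/section_mono/under_section_sigma/iso_epi.
  + by apply: under_epi_sigma => M; exact: iso_mono.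
  + exact/sigma_mono/iso_epi.
  + exact/sigma_epi/iso_section.
Qed.
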